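(* Let $M$ be a finite dimensional $C^*$-algebra, let $\omega$ be a faithful tracial state on $M$, and let $(B,\Delta_B)$ be a compact quantum semigroup acting on $\mathscr{QS}(M)$ with action $\Phi_B\in\mathrm{Mor}(M,M\otimes B)$ such that the set $\{(\eta\otimes\mathrm{id})\Phi_B(m) : m\in M,\ \eta\in M^*\}$ generates $B$ as a $C^*$-algebra. Assume further that $\omega$ is invariant for $\Phi_B$. Then $(B,\Delta_B)$ has cancellation from the left, i.e. the set $\{(a\otimes I)\Delta_B(b) : a,b\in B\}$ is linearly dense in $B\otimes B$. If, moreover, the set $\{\Phi_B(m)(I\otimes a) : m\in M,\ a\in B\}$ is linearly dense in $M\otimes B$, then $(B,\Delta_B)$ has cancellation from the right, i.e. the linear span of $\{\Delta_B(a)(I\otimes b) : a,b\in B\}$ is dense in $B\otimes B$.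
   Context: $\otimes$ is the minimal tensor product of $C^*$-algebras; $M^*$ is the dual space of $M$; $\mathrm{Mor}(A,B)$ is the set of nondegenerate $*$-homomorphisms from $A$ to the multiplier algebra $\mathrm{M}(B)$ (for unital $A,B$: unital $*$-homomorphisms $A\to B$). A compact quantum semigroup is a pair $(B,\Delta_B)$ of a unital $C^*$-algebra $B$ and $\Delta_B\in\mathrm{Mor}(B,B\otimes B)$ that is coassociative: $(\Delta_B\otimes\mathrm{id})\circ\Delta_B=(\mathrm{id}\otimes\Delta_B)\circ\Delta_B$. An action of $(B,\Delta_B)$ on $\mathscr{QS}(M)$ is $\Phi_B\in\mathrm{Mor}(M,M\otimes B)$ with $(\Phi_B\otimes\mathrm{id})\circ\Phi_B=(\mathrm{id}\otimes\Delta_B)\circ\Phi_B$. The state $\omega$ is invariant for $\Phi_B$ if $(\omega\otimes\mathrm{id})\Phi_B(m)=\omega(m)I$ for all $m\in M$. A subset is linearly dense if its linear span is norm dense. *)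

(* Defs.v *)
From HB Require Import structures.
From mathcomp Require Import all_boot all_order all_algebra.
From mathcomp Require Import complex.
From mathcomp Require Import all_classical all_reals all_analysis.

Set Implicit Arguments.
Unset Strict Implicit.
Unset Printing Implicit Defensive.

Import Order.TTheory GRing.Theory Num.Theory.
Import numFieldNormedType.Exports.

Local Open Scope classical_set_scope.
Local Open Scope ring_scope.

(* A unital C*-algebra may be zero, which the library's algType excludes, and a
   structure joining pzRingType to the normed types cannot be declared
   downstream of numDomainType: the product is therefore part of the mixin, and
   the pzRingType structure is derived from it below.  Norms take their values
   in the field of scalars. *)
HB.mixin Record isCStarAlgebra (C : numClosedFieldType) A
    of CompleteNormedModule C A := {
  cstar_one : A;
  cstar_mul : A -> A -> A;
  star : A -> A;
  cstar_mulA : associative cstar_mul;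
  cstar_mul1l : left_id cstar_one cstar_mul;
  cstar_mul1r : right_id cstar_one cstar_mul;
  cstar_mulDl : left_distributive cstar_mul +%R;
  cstar_mulDr : right_distributive cstar_mul +%R;
  cstar_scaleAl : forall (c : C) (x y : A),
    c *: cstar_mul x y = cstar_mul (c *: x) y;
  cstar_scaleAr : forall (c : C) (x y : A),
    c *: cstar_mul x y = cstar_mul x (c *: y);
  cstar_normM : forall x y : A, `|cstar_mul x y| <= `|x| * `|y|;
  starD : forall x y : A, star (x + y) = star x + star y;
  starZ : forall (c : C) (x : A), star (c *: x) = c^* *: star x;
  starM : forall x y : A, star (cstar_mul x y) = cstar_mul (star y) (star x);
  starK : forall x : A, star (star x) = x;
  cstar_identity : forall x : A, `|cstar_mul (star x) x| = `|x| ^+ 2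
}.

#[short(type="cstarAlgType")]
HB.structure Definition CStarAlgebra (C : numClosedFieldType) :=
  {A of isCStarAlgebra C A & CompleteNormedModule C A}.

HB.instance Definition _ (C : numClosedFieldType) (A : cstarAlgType C) :=
  GRing.Zmodule_isPzRing.Build (CStarAlgebra.sort A)
    (@cstar_mulA C A) (@cstar_mul1l C A) (@cstar_mul1r C A)
    (@cstar_mulDl C A) (@cstar_mulDr C A).

(* The inner product is linear in its first argument. *)
HB.mixin Record isHilbert (C : numClosedFieldType) H
    of CompleteNormedModule C H := {
  dot : H -> H -> C;
  dotDl : forall x y z : H, dot (x + y) z = dot x z + dot y z;
  dotZl : forall (c : C) (x y : H), dot (c *: x) y = c * dot x y;
  dotC : forall x y : H, dot y x = (dot x y)^*;
  dot_norm : forall x : H, dot x x = `|x| ^+ 2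
}.

#[short(type="hilbertType")]
HB.structure Definition Hilbert (C : numClosedFieldType) :=
  {H of isHilbert C H & CompleteNormedModule C H}.

Section LinearSpan.
Context {C : numClosedFieldType} {V : normedModType C}.

Definition lspan (S : set V) : set V :=
  [set x | exists n (c : 'I_n -> C) (s : 'I_n -> V),
     (forall i, S (s i)) /\ x = \sum_(i < n) c i *: s i].

Definition linearly_dense (S : set V) : Prop := dense (lspan S).

Definition finite_dimensional : Prop :=
  exists n (e : 'I_n -> V), lspan (range e) = setT.

End LinearSpan.
Arguments finite_dimensional {C} V.

Definition bilinear_map (C : numClosedFieldType) (U V W : lmodType C)
    (f : U -> V -> W) : Prop :=
  (forall v, linear (f^~ v)) /\ (forall u, linear (f u)).

(* Mor(A, B) for unital A and B. *)
Definition star_morphism (C : numClosedFieldType) (A B : cstarAlgType C)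
    (f : A -> B) : Prop :=
  [/\ linear f, {morph f : x y / x * y}, f 1 = 1 & {morph f : x / star x}].

Definition is_opnorm (C : numClosedFieldType) (H K : normedModType C)
    (f : H -> K) (r : C) : Prop :=
  (forall x, `|f x| <= r * `|x|) /\
  (forall k, 0 <= k -> (forall x, `|f x| <= k * `|x|) -> r <= k).

(* pi identifies A with a norm-closed *-algebra of operators on H; neither
   unitality nor nondegeneracy of pi is required. *)
Definition concrete_rep (C : numClosedFieldType) (A : cstarAlgType C)
    (H : hilbertType C) (pi : A -> H -> H) : Prop :=
  [/\ bilinear_map pi,
      forall a b x, pi (a * b) x = pi a (pi b x),
      forall a x y, dot (pi (star a) x) y = dot x (pi a y) &
      forall a, is_opnorm (pi a) `|a|].

Definition hilbert_tensor (C : numClosedFieldType) (H K L : hilbertType C)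
    (h : H -> K -> L) : Prop :=
  [/\ bilinear_map h,
      forall x y x' y', dot (h x y) (h x' y') = dot x x' * dot y y' &
      linearly_dense [set h x y | x in [set: H] & y in [set: K]]].

(* T, with t a b in the role of a (x) b, is the minimal (spatial) tensor
   product of A and B: for concrete realisations pi of A on H and rho of B on
   K, it is realised on the Hilbert space H (x) K as the norm closure of the
   span of the operators pi a (x) rho b.  As the spatial norm does not depend
   on pi and rho, this determines T up to a unique isomorphism. *)
Definition min_tensor_product (C : numClosedFieldType)
    (A B T : cstarAlgType C) (t : A -> B -> T) : Prop :=
  linearly_dense [set t a b | a in [set: A] & b in [set: B]] /\
  exists (H K L : hilbertType C) (h : H -> K -> L)
         (pi : A -> H -> H) (rho : B -> K -> K) (sigma : T -> L -> L),
    [/\ concrete_rep pi, concrete_rep rho, hilbert_tensor h,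
        concrete_rep sigma &
        forall a b x y, sigma (t a b) (h x y) = h (pi a x) (rho b y)].

Record minTensor (C : numClosedFieldType) (A B : cstarAlgType C) := MinTensor {
  tensor_alg :> cstarAlgType C;
  tens : A -> B -> tensor_alg;
  tensP : min_tensor_product tens
}.
Arguments tens {C A B m}.

(* A (x) B (x) D: one algebra carrying both bracketings, (A (x) B) (x) D and
   A (x) (B (x) D), identified by associativity. *)
Record minTensor3 (C : numClosedFieldType) (A B D : cstarAlgType C)
    (AB : minTensor A B) (BD : minTensor B D) := MinTensor3 {
  tensor3_alg :> cstarAlgType C;
  tensl : AB -> D -> tensor3_alg;
  tensr : A -> BD -> tensor3_alg;
  tenslP : min_tensor_product tensl;
  tensrP : min_tensor_product tensr;
  tens3A : forall a b d, tensl (tens a b) d = tensr a (tens b d)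
}.
Arguments tensl {C A B D AB BD m}.
Arguments tensr {C A B D AB BD m}.

(* F is the continuous linear map on the tensor product with
   F (a (x) b) = f a b.  There is at most one such F, by density. *)
Definition tensor_lift (C : numClosedFieldType) (A B T : cstarAlgType C)
    (t : A -> B -> T) (V : normedModType C) (f : A -> B -> V)
    (F : T -> V) : Prop :=
  [/\ linear F, continuous F & forall a b, F (t a b) = f a b].

Section QuantumSemigroup.
Context {C : numClosedFieldType} {M B : cstarAlgType C}.
Context {MB : minTensor M B} {BB : minTensor B B}.

(* DI and ID are the maps Delta (x) id and id (x) Delta. *)
Definition coassociative (BBB : minTensor3 BB BB) (Delta : B -> BB) : Prop :=
  exists DI ID : BB -> BBB,
    [/\ tensor_lift tens (fun a b => tensl (Delta a) b) DI,
        tensor_lift tens (fun a b => tensr a (Delta b)) ID &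
        forall b, DI (Delta b) = ID (Delta b)].

Definition compact_quantum_semigroup (BBB : minTensor3 BB BB)
    (Delta : B -> BB) : Prop :=
  star_morphism Delta /\ coassociative BBB Delta.

(* PI and ID are the maps Phi (x) id and id (x) Delta. *)
Definition quantum_action (MBB : minTensor3 MB BB) (Delta : B -> BB)
    (Phi : M -> MB) : Prop :=
  star_morphism Phi /\
  exists PI ID : MB -> MBB,
    [/\ tensor_lift tens (fun m b => tensl (Phi m) b) PI,
        tensor_lift tens (fun m b => tensr m (Delta b)) ID &
        forall m, PI (Phi m) = ID (Phi m)].

(* S is the slice map eta (x) id. *)
Definition is_slice (eta : M -> C^o) (S : MB -> B) : Prop :=
  tensor_lift tens (fun m b => eta m *: b) S.

Definition slice_coefficients (Phi : M -> MB) : set B :=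
  [set b | exists (eta : M -> C^o) (S : MB -> B) (m : M),
     [/\ linear eta, continuous eta, is_slice eta S & b = S (Phi m)]].

Definition invariant_functional (omega : M -> C^o) (Phi : M -> MB) : Prop :=
  exists S : MB -> B, is_slice omega S /\ forall m, S (Phi m) = omega m *: (1 : B).

End QuantumSemigroup.

Section States.
Context {C : numClosedFieldType} {A : cstarAlgType C}.

Definition state (omega : A -> C^o) : Prop :=
  [/\ linear omega, forall x, 0 <= omega (star x * x) & omega 1 = 1].

Definition faithful (omega : A -> C^o) : Prop :=
  forall x, omega (star x * x) = 0 -> x = 0.

Definition tracial (omega : A -> C^o) : Prop :=
  forall x y, omega (x * y) = omega (y * x).

Definition cstar_subalgebra (D : set A) : Prop :=
  [/\ D 0, forall (c : C) x y, D x -> D y -> D (c *: x + y),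
      forall x y, D x -> D y -> D (x * y), forall x, D x -> D (star x) &
      closed D].

Definition generates_cstar (S : set A) : Prop :=
  forall D : set A, cstar_subalgebra D -> S `<=` D -> D = setT.

End States.

(* Main.v *)
From HB Require Import structures.
Require Import Defs.
From mathcomp Require Import all_boot all_order all_algebra.
From mathcomp Require Import complex ring.
From mathcomp Require Import all_classical all_reals all_analysis.

(** Let [f] be a basis of [M] that is orthonormal for the inner product
    [omega (star y * x)], and expand [Phi (f j)] as the sum over [i] of
    [f i (x) u i j].  The theorem is an interplay between three identities for
    the matrix [u] of coefficients.

    - The action equation, compared coefficientwise, says that
      [Delta (u k j)] is the sum over [i] of [u k i (x) u i j]
      ([coefficients_corepresentation]).
    - Invariance of [omega], applied to [Phi (star (f i) * f j)], says that
      [u^* u = 1] ([coefficients_isometry]).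
    - If [Phi(M)(1 (x) B)] is linearly dense, the isometry [u] has dense range,
      hence [u u^* = 1] as well ([coefficients_coisometry]).

    Because [omega] is a trace, the adjoints [star (f i)] form another
    orthonormal basis ([onb_star]); its coefficients are the [star (u i j)].  So
    everything said about [u] also holds for the entrywise adjoint of [u], which
    is where traciality enters: isometry of [u] alone would not give it.

    From [u^* u = 1] one gets
    [1 (x) u i j = \sum_k (star (u k i) (x) 1) Delta (u k j)]
    ([left_leg_elimination]), and similarly for the adjoints.  The elements [c]
    for which [1 (x) c] and [1 (x) star c] lie in the closed span [E] of
    [(B (x) 1) Delta(B)] form a C*-subalgebra, since [1 (x) c] commutes with
    [B (x) 1]; it contains the generators, so it is all of [B], and
    [E = B (x) B] follows on multiplying by [B (x) 1]
    ([cancellation_criterion]).  For cancellation from the right the same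
    argument is run with the legs of the tensor product exchanged, where
    [u u^* = 1] replaces [u^* u = 1]; it yields density of
    [(1 (x) B) Delta(B)], and the adjoint of that set is [Delta(B) (1 (x) B)].

    The algebra of minimal tensor products that this needs (products, adjoints,
    continuity of [b |-> a (x) b], independence of coefficients) is read off
    from a concrete representation. *)

Set Implicit Arguments.
Unset Strict Implicit.
Unset Printing Implicit Defensive.

Import Order.TTheory GRing.Theory Num.Theory.
Import numFieldNormedType.Exports.

Local Open Scope classical_set_scope.
Local Open Scope ring_scope.

(** * Linear density *)

(** Trades the unbundled hypothesis [linear f] for a bundled map, to which the
    rewriting rules for morphisms apply. *)
Lemma linear_pack (C : numClosedFieldType) (U V : lmodType C) (f : U -> V) :
  linear f -> exists l : {linear U -> V}, f = l.
Proof.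
move=> lf.
by exists (HB.pack f (GRing.isLinear.Build _ _ _ _ f lf) : {linear U -> V}).
Qed.

Section Density.
Context {C : numClosedFieldType}.

Lemma bounded_additive_continuous (V W : normedModType C) (f : V -> W) (k : C) :
  {morph f : x y / x - y} -> (forall x, `|f x| <= k * `|x|) -> continuous f.
Proof.
move=> fB fk x.
(* [k] may be negative or not real when [V] is trivial, hence [`|k| + 1] *)
have k1 : 0 < `|k| + 1 by rewrite ltr_wpDl.
apply/cvgrPdist_lt => e e0; near=> y.
rewrite -fB (le_lt_trans (fk _)) //.
have : `|x - y| < e / (`|k| + 1).
  by near: y; apply: cvgr_dist_lt; rewrite // divr_gt0.
rewrite ltr_pdivlMr // mulrC; apply: le_lt_trans.
have [->|nz] := eqVneq `|x - y| 0; first by rewrite !mulr0.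
have : 0 <= k * `|x - y| by apply: le_trans (fk _).
rewrite pmulr_lge0 ?lt0r ?nz //= => k0.
by rewrite ger0_norm // ler_wpM2r // lerDl.
Unshelve. all: by end_near.
Qed.

Lemma linear_norm_continuous (V W : normedModType C) (f : V -> W) (k : C) :
  linear f -> (forall x, `|f x| <= k * `|x|) -> continuous f.
Proof.
move=> /linear_pack[l ->]; apply: bounded_additive_continuous.
exact: linearB.
Qed.

Lemma closed_preimage (V W : normedModType C) (f : V -> W) (D : set W) :
  continuous f -> closed D -> closed (f @^-1` D).
Proof. by move=> /continuous_closedP; apply. Qed.

Definition closed_subspace (V : normedModType C) (D : set V) : Prop :=
  [/\ D 0, forall (c : C) x y, D x -> D y -> D (c *: x + y) & closed D].

Lemma closed_subspace_sum (V : normedModType C) (D : set V) (n : nat)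
    (x : 'I_n -> V) :
  closed_subspace D -> (forall i, D (x i)) -> D (\sum_(i < n) x i).
Proof.
move=> [D0 DD _] Dx; elim/big_ind: _ => // y z Dy Dz.
by rewrite -[y]scale1r; exact: DD.
Qed.

Lemma closed_subspaceZ (V : normedModType C) (D : set V) (c : C) (x : V) :
  closed_subspace D -> D x -> D (c *: x).
Proof. by move=> [D0 DD _] Dx; rewrite -[_ *: _]addr0; exact: DD. Qed.

Lemma closed_subspace_preimage (V W : normedModType C) (f : V -> W)
    (D : set W) :
  linear f -> continuous f -> closed_subspace D -> closed_subspace (f @^-1` D).
Proof.
move=> /linear_pack[l ->] cl [D0 DD clD]; split; rewrite /preimage /=.
- by rewrite linear0.
- by move=> c x y Dx Dy; rewrite linearP; exact: DD.
- exact: closed_preimage.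
Qed.

Lemma closed_subspace_eq (V W : normedModType C) (f g : V -> W) :
  linear f -> continuous f -> linear g -> continuous g ->
  closed_subspace [set x | f x = g x].
Proof.
move=> /linear_pack[l ->] cl /linear_pack[m ->] cm; split => /=.
- by rewrite !linear0.
- by move=> c x y e e'; rewrite !linearP e e'.
have -> : [set x | l x = m x] = (fun x => l x - m x) @^-1` [set 0].
  apply/seteqP; split=> x; rewrite /preimage /= => /eqP.
    by rewrite -subr_eq0 => /eqP.
  by rewrite subr_eq0 => /eqP.
apply: closed_preimage; last first.
  exact/accessible_closed_set1/hausdorff_accessible/norm_hausdorff.
by move=> x; apply: cvgB; [exact: cl | exact: cm].
Qed.

Lemma lspan_incl (V : normedModType C) (S : set V) : S `<=` lspan S.
Proof.
move=> x Sx; exists 1%N, (fun _ => 1), (fun _ => x); split => //.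
by rewrite big_ord1 scale1r.
Qed.

Lemma lspan_linear (V : normedModType C) (S : set V) (c : C) (x y : V) :
  lspan S x -> lspan S y -> lspan S (c *: x + y).
Proof.
move=> [n [a [s [Ss ->]]]] [m [b [r [Sr ->]]]].
exists (n + m)%N,
  (fun i : 'I_(n + m) =>
     match fintype.split i with inl j => c * a j | inr j => b j end),
  (fun i : 'I_(n + m) =>
     match fintype.split i with inl j => s j | inr j => r j end); split.
  by move=> i; case: fintype.split.
rewrite big_split_ord /= scaler_sumr; congr (_ + _); apply: eq_bigr => i _.
  by rewrite (unsplitK (inl i)) scalerA.
by rewrite (unsplitK (inr i)).
Qed.

Lemma lspan_min (V : normedModType C) (S D : set V) :
  closed_subspace D -> S `<=` D -> lspan S `<=` D.
Proof.
move=> cD SD _ [n [c [s [Ss ->]]]]; apply: closed_subspace_sum => // i.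
by apply: closed_subspaceZ => //; exact: SD.
Qed.

Definition cspan (V : normedModType C) (S : set V) : set V :=
  closure (lspan S).

Lemma cspan_min (V : normedModType C) (S D : set V) :
  closed_subspace D -> S `<=` D -> cspan S `<=` D.
Proof.
move=> cD SD x /(closure_subset (lspan_min cD SD)).
by case: cD => _ _ /closure_id <-.
Qed.

Lemma cspan_incl (V : normedModType C) (S : set V) : S `<=` cspan S.
Proof. by move=> x Sx; apply: subset_closure; exact: lspan_incl. Qed.

Lemma continuous_affine (V : normedModType C) (c : C) (y : V) :
  continuous (fun x : V => c *: x + y).
Proof.
move=> x; apply: cvgD; last exact: cvg_cst.
by apply: (@cvgZl_tmp _ _ _ _ _ c id); exact: cvg_id.
Qed.

Lemma cspan_closed_subspace (V : normedModType C) (S : set V) :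
  closed_subspace (cspan S).
Proof.
have cl := @closed_closure _ (lspan S).
split => //.
  apply: subset_closure; exists 0%N, (fun _ => 0), (fun _ => 0); split.
    by case.
  by rewrite big_ord0.
have addl c x y : lspan S y -> cspan S x -> cspan S (c *: x + y).
  move=> Sy Sx.
  have := closed_preimage (@continuous_affine _ c y) cl.
  move=> /closure_id; rewrite /preimage => E.
  suff: closure (fun x => cspan S (c *: x + y)) x by rewrite /cspan -E.
  apply: closure_subset Sx => z Sz.
  by apply: subset_closure; exact: lspan_linear.
move=> c x y Sx Sy.
have := closed_preimage (@continuous_affine _ 1 (c *: x)) cl.
move=> /closure_id; rewrite /preimage => E.
rewrite addrC -[y]scale1r.
suff: closure (fun y => cspan S (1 *: y + c *: x)) y by rewrite /cspan -E.
apply: closure_subset Sy => z Sz.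
by rewrite /= scale1r addrC; exact: addl.
Qed.

Lemma linearly_denseP (V : normedModType C) (S : set V) :
  linearly_dense S <-> forall x, cspan S x.
Proof.
split=> [dS x U /nbhs_interior Ux | cS U [x Ux] oU].
  have [y [Uy Sy]] := dS _ (ex_intro _ x (nbhs_singleton Ux)) (@open_interior _ _).
  by exists y; split => //; exact: interior_subset.
by have [y [Sy Uy]] := cS x U (open_nbhs_nbhs (conj oU Ux)); exists y.
Qed.

(** The way linear density is used: a property which defines a closed subspace
    only has to be checked on the generators. *)
Lemma linearly_dense_ind (V : normedModType C) (S D : set V) :
  linearly_dense S -> closed_subspace D -> S `<=` D -> forall x, D x.
Proof. by move=> /linearly_denseP dS cD SD x; exact: (cspan_min cD SD). Qed.

Lemma linearly_dense_eq (V W : normedModType C) (S : set V) (f g : V -> W) :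
  linearly_dense S -> linear f -> continuous f -> linear g -> continuous g ->
  (forall x, S x -> f x = g x) -> forall x, f x = g x.
Proof.
move=> dS lf cf lg cg fg.
exact: (linearly_dense_ind dS (closed_subspace_eq lf cf lg cg) fg).
Qed.

End Density.

(** * Inner products and orthonormal families *)

Section InnerProduct.
Context {C : numClosedFieldType} {V : lmodType C}.

Definition inner_product (d : V -> V -> C) : Prop :=
  [/\ forall (c : C) x y z, d (c *: x + y) z = c * d x z + d y z,
      forall x y, d y x = (d x y)^*,
      forall x, 0 <= d x x &
      forall x, d x x = 0 -> x = 0].

Definition orthonormal (d : V -> V -> C) (n : nat) (f : 'I_n -> V) : Prop :=
  forall i j, d (f i) (f j) = (i == j)%:R.

Definition expands (d : V -> V -> C) (n : nat) (f : 'I_n -> V) (x : V) : Prop :=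
  x = \sum_(j < n) d x (f j) *: f j.

Variable (d : V -> V -> C).
Hypothesis dP : inner_product d.

Lemma ip0l y : d 0 y = 0.
Proof.
have [dl _ _ _] := dP; have := dl 1 0 0 y.
by rewrite scaler0 addr0 mul1r => /(congr1 (fun x => x - d 0 y)); rewrite subrr addrK.
Qed.

Lemma ipDl x x' y : d (x + x') y = d x y + d x' y.
Proof. by have [dl _ _ _] := dP; rewrite -[x]scale1r dl scale1r mul1r. Qed.

Lemma ipZl c x y : d (c *: x) y = c * d x y.
Proof. by have [dl _ _ _] := dP; rewrite -[c *: x]addr0 dl ip0l addr0. Qed.

Lemma ipC x y : d y x = (d x y)^*.
Proof. by have [_ dC _ _] := dP; exact: dC. Qed.

Lemma ip0r y : d y 0 = 0.
Proof. by rewrite ipC ip0l rmorph0. Qed.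

Lemma ipDr x y y' : d x (y + y') = d x y + d x y'.
Proof. by rewrite ipC ipDl rmorphD /= -!ipC. Qed.

Lemma ipZr c x y : d x (c *: y) = c^* * d x y.
Proof. by rewrite ipC ipZl rmorphM /= -ipC. Qed.

Lemma ip_suml n (x : 'I_n -> V) y : d (\sum_i x i) y = \sum_i d (x i) y.
Proof. by apply: (big_morph (d^~ y)) => [u v|]; [rewrite ipDl | rewrite ip0l]. Qed.

Lemma ip_sumr n (x : 'I_n -> V) y : d y (\sum_i x i) = \sum_i d y (x i).
Proof. by apply: (big_morph (d y)) => [u v|]; [rewrite ipDr | rewrite ip0r]. Qed.

(** The vectors [e i] may be dependent, so the number of vectors produced is not
    prescribed. *)
Lemma gram_schmidt n (e : 'I_n -> V) :
  exists m (f : 'I_m -> V), orthonormal d f /\ forall i, expands d f (e i).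
Proof.
elim: n e => [|n IHn] e; first by exists 0%N, (fun _ => 0); split; case.
have [m [f [fo fe]]] := IHn (fun i => e (lift ord0 i)).
pose r := e ord0 - \sum_(j < m) d (e ord0) (f j) *: f j.
have e0r : e ord0 = r + \sum_(j < m) d (e ord0) (f j) *: f j by rewrite subrK.
have sumf (c : 'I_m -> C) k : d (\sum_j c j *: f j) (f k) = c k.
  rewrite ip_suml (bigD1 k) //= ipZl fo eqxx mulr1 big1 ?addr0 // => j jk.
  by rewrite ipZl fo (negbTE jk) mulr0.
have rf k : d r (f k) = 0.
  have := congr1 (d^~ (f k)) e0r; rewrite /= ipDl sumf -{1}[d _ _]add0r.
  by move/addIr.
have [r0|r0] := eqVneq r 0.
  exists m, f; split=> // i; have [j|] := unliftP ord0 i; first by move=> ->.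
  by move=> ->; rewrite /expands {1}e0r r0 add0r.
have [_ _ d0 dI] := dP.
(* [r] is the component of the new vector orthogonal to the old ones *)
pose c := sqrtC (d r r).
have c0 : c != 0 by rewrite sqrtC_eq0; apply/negP => /eqP/dI/eqP; apply/negP.
have cc : c^* = c by apply/CrealP/ger0_real; rewrite sqrtC_ge0.
have c2 : c * c = d r r by rewrite -expr2 sqrtCK.
pose g := c^-1 *: r.
have gf k : d g (f k) = 0 by rewrite ipZl rf mulr0.
have fg k : d (f k) g = 0 by rewrite ipC gf rmorph0.
have gg : d g g = 1.
  by rewrite ipZl ipZr -c2 fmorphV /= cc mulKf // mulVf.
exists m.+1, (fun i => if unlift ord0 i is Some j then f j else g); split.
  move=> i j; case: (unliftP ord0 i) => [i'|] ->; case: (unliftP ord0 j) => [j'|] -> //=.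
move=> i; rewrite /expands big_ord_recl unlift_none.
under eq_bigr => j _ do rewrite liftK.
case: (unliftP ord0 i) => [i'|] ->.
  have -> : d (e (lift ord0 i')) g = 0; last by rewrite scale0r add0r; exact: fe.
  rewrite fe ip_suml big1 // => j _; by rewrite ipZl fg mulr0.
have -> : d (e ord0) g = c.
  rewrite e0r ipDl ip_suml big1 ?addr0; last by move=> j _; rewrite ipZl fg mulr0.
  by rewrite ipZr -c2 fmorphV /= cc mulKf.
by rewrite scalerA divff // scale1r.
Qed.

End InnerProduct.

Lemma dot_inner_product (C : numClosedFieldType) (H : hilbertType C) :
  inner_product (@dot C H).
Proof.
split.
- by move=> c x y z; rewrite dotDl dotZl.
- exact: dotC.
- by move=> x; rewrite dot_norm exprn_ge0.
- by move=> x; rewrite dot_norm => /eqP; rewrite expf_eq0 normr_eq0 => /eqP.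
Qed.

(** * Concrete representations and the minimal tensor product *)

Section CStar.
Context {C : numClosedFieldType} {A : cstarAlgType C}.
Implicit Types x y : A.

Lemma scale_mull (c : C) x y : c *: (x * y) = (c *: x) * y.
Proof. exact: cstar_scaleAl. Qed.

Lemma scale_mulr (c : C) x y : c *: (x * y) = x * (c *: y).
Proof. exact: cstar_scaleAr. Qed.

Lemma star0 : star (0 : A) = 0.
Proof. by have := starZ 0 (0 : A); rewrite scale0r rmorph0 scale0r. Qed.

Lemma starB x y : star (x - y) = star x - star y.
Proof. by rewrite starD -scaleN1r -[- star y]scaleN1r starZ rmorphN rmorph1. Qed.

Lemma star_sum n (x : 'I_n -> A) : star (\sum_i x i) = \sum_i star (x i).
Proof. exact: (big_morph _ (@starD C A) star0). Qed.

Lemma starMr x y : star (x * y) = star y * star x.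
Proof. exact: starM. Qed.

Lemma star1 : star (1 : A) = 1.
Proof. by have := starMr (star 1) 1; rewrite mulr1 starK mulr1. Qed.

(** The C*-identity gives [`|z| ^+ 2 <= `|star z| * `|z|]; applying this to
    [star z] as well gives equality. *)
Lemma norm_star x : `|star x| = `|x|.
Proof.
suff le (z : A) : `|z| <= `|star z|.
  by apply/le_anti; rewrite le -{2}[x]starK le.
have [->|nz] := eqVneq `|z| 0; first exact: normr_ge0.
have z0 : 0 < `|z| by rewrite lt0r nz normr_ge0.
by rewrite -(ler_pM2r z0) -expr2 -cstar_identity cstar_normM.
Qed.

Lemma star_continuous : continuous (@star C A).
Proof.
apply: (@bounded_additive_continuous _ _ _ _ 1); first exact: starB.
by move=> x; rewrite norm_star mul1r.
Qed.

Lemma mull_linear a : linear (fun x => a * x).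
Proof. by move=> c x y; rewrite mulrDr scale_mulr. Qed.

Lemma mulr_linear a : linear (fun x => x * a).
Proof. by move=> c x y; rewrite mulrDl scale_mull. Qed.

Lemma mull_continuous a : continuous (fun x => a * x).
Proof.
apply: (@bounded_additive_continuous _ _ _ _ `|a|); first exact: mulrBr.
by move=> x; exact: cstar_normM.
Qed.

Lemma mulr_continuous a : continuous (fun x => x * a).
Proof.
apply: (@bounded_additive_continuous _ _ _ _ `|a|).
  by move=> x y; exact: mulrBl.
by move=> x; rewrite mulrC; exact: cstar_normM.
Qed.

End CStar.

Section ConcreteRep.
Context {C : numClosedFieldType}.

Lemma concrete_rep_continuous (A : cstarAlgType C) (H : hilbertType C)
    (pi : A -> H -> H) (a : A) :
  concrete_rep pi -> continuous (pi a).
Proof.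
move=> [[_ pil] _ _ pin]; apply: linear_norm_continuous (pil a) _.
by have [] := pin a.
Qed.

Lemma concrete_rep_inj (A : cstarAlgType C) (H : hilbertType C)
    (pi : A -> H -> H) (a b : A) :
  concrete_rep pi -> pi a =1 pi b -> a = b.
Proof.
move=> [[pil _] _ _ pin] eab; apply/eqP; rewrite -subr_eq0 -normr_le0.
have [_] := pin (a - b); apply=> // x.
have [l pl] := linear_pack (pil x).
by rewrite mul0r -[pi _ _]/(pi^~ x (a - b)) pl linearB -pl /= eab subrr normr0.
Qed.

(** By Pythagoras, every vector orthogonal to [z] is at distance at least [`|z|]
    from it, so a nonzero [z] is not a limit of such vectors. *)
Lemma orth_dense0 (H : hilbertType C) (S : set H) (z : H) :
  linearly_dense S -> (forall w, S w -> dot z w = 0) -> z = 0.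
Proof.
move=> /linearly_denseP /(_ z) clz zS; apply/eqP; rewrite -normr_eq0.
have orth w : lspan S w -> dot z w = 0.
  move=> [n [c [s [Ss ->]]]]; rewrite (ip_sumr (dot_inner_product H)) big1 // => i _.
  by rewrite (ipZr (dot_inner_product H)) zS // mulr0.
apply: contraT => nz.
have z0 : 0 < `|z| by rewrite lt0r nz normr_ge0.
have [w [Sw]] := clz _ (@nbhsx_ballx _ _ z _ z0).
rewrite -ball_normE /ball_ /=.
rewrite -(ltr_pXn2r (n := 2)) ?nnegrE ?normr_ge0 //.
have dH := dot_inner_product H.
rewrite -!dot_norm (ipDl dH) !(ipDr dH) -scaleN1r !(ipZl dH, ipZr dH).
rewrite [dot w z]dotC (orth _ Sw) rmorph0 !mulr0 addr0 add0r mulrA.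
rewrite rmorphN rmorph1 mulrNN !mul1r gtrDl.
by rewrite dot_norm le_gtF ?exprn_ge0.
Qed.

End ConcreteRep.

Section HilbertTensor.
Context {C : numClosedFieldType} {H K L : hilbertType C} {h : H -> K -> L}.
Hypothesis hT : hilbert_tensor h.

Lemma hilbert_tensor_suml n (x : 'I_n -> H) y :
  h (\sum_i x i) y = \sum_i h (x i) y.
Proof.
have [[hl _] _ _] := hT; have [l pl] := linear_pack (hl y).
by rewrite -[h _ _]/(h^~ y _) pl linear_sum -pl.
Qed.

Lemma hilbert_tensor_sumr n x (y : 'I_n -> K) :
  h x (\sum_i y i) = \sum_i h x (y i).
Proof.
have [[_ hr] _ _] := hT; have [l pl] := linear_pack (hr x).
by rewrite pl linear_sum.
Qed.

Lemma hilbert_tensorZ c x y : h (c *: x) y = h x (c *: y).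
Proof.
have [[hl hr] _ _] := hT; have [l pl] := linear_pack (hl y).
have [m pm] := linear_pack (hr x).
by rewrite -[LHS]/(h^~ y _) pl linearZ -pl /= pm linearZ.
Qed.

Lemma hilbert_tensor_pythagoras n (f : 'I_n -> H) (z : 'I_n -> K) :
  orthonormal (@dot C H) f ->
  `|\sum_i h (f i) (z i)| ^+ 2 = \sum_i `|z i| ^+ 2.
Proof.
move=> fo; have [_ hdot _] := hT; have dL := dot_inner_product L.
rewrite -dot_norm (ip_suml dL); apply: eq_bigr => i _.
rewrite (ip_sumr dL) (bigD1 i) //= hdot fo eqxx mul1r dot_norm big1 ?addr0 // => j ji.
by rewrite hdot fo eq_sym (negbTE ji) mul0r.
Qed.

(** Expanding the first legs in an orthonormal family turns a sum of simple
    tensors into an orthogonal one, on which the bound is visible termwise. *)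
Lemma hilbert_tensor_op_bound n (x : 'I_n -> H) (y : 'I_n -> K) (T : K -> K) (r : C) :
  linear T -> 0 <= r -> (forall v, `|T v| <= r * `|v|) ->
  `|\sum_i h (x i) (T (y i))| <= r * `|\sum_i h (x i) (y i)|.
Proof.
move=> /linear_pack[l ->] r0 lr.
have [m [f [fo fx]]] := gram_schmidt (dot_inner_product H) x.
have regroup (v : 'I_n -> K) : \sum_i h (x i) (v i) =
    \sum_j h (f j) (\sum_i dot (x i) (f j) *: v i).
  under [RHS]eq_bigr => j _ do rewrite hilbert_tensor_sumr.
  rewrite exchange_big /=; apply: eq_bigr => i _.
  rewrite {1}fx hilbert_tensor_suml; apply: eq_bigr => j _.
  exact: hilbert_tensorZ.
rewrite -(ler_pXn2r (n := 2)) ?nnegrE ?mulr_ge0 //.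
rewrite exprMn !regroup !hilbert_tensor_pythagoras // mulr_sumr.
apply: ler_sum => j _; rewrite -exprMn.
rewrite ler_pXn2r ?nnegrE ?mulr_ge0 //.
under eq_bigr => i _ do rewrite -linearZ.
by rewrite -linear_sum.
Qed.

Lemma hilbert_tensor_flip : hilbert_tensor (fun y x => h x y).
Proof.
have [[hl hr] hdot hd] := hT; split; first by split.
  by move=> y x y' x'; rewrite hdot mulrC.
congr (linearly_dense _): hd; apply/seteqP; split=> z.
  by move=> [x _ [y _ <-]]; exists y => //; exists x.
by move=> [y _ [x _ <-]]; exists x => //; exists y.
Qed.

End HilbertTensor.

(** The a priori bound [m] serves only to make [f] continuous; the bound that
    holds on the span of [S] then passes to the limit. *)
Lemma dense_norm_bound (C : numClosedFieldType) (V W : normedModType C)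
    (f : V -> W) (S : set V) (k m : C) :
  linear f -> (forall z, `|f z| <= m * `|z|) -> linearly_dense S -> 0 <= k ->
  (forall z, lspan S z -> `|f z| <= k * `|z|) -> forall z, `|f z| <= k * `|z|.
Proof.
move=> /linear_pack[l ->] lm /linearly_denseP dS k0 lk z.
apply/ler_addgt0Pr => e e0.
have s0 : 0 < k + `|m| + 1 by rewrite ltr_wpDl // addr_ge0.
have [w [Sw]] := dS z _ (@nbhsx_ballx _ _ z _ (divr_gt0 e0 s0)).
rewrite -ball_normE /ball_ /= ltr_pdivlMr // => zw.
have lw : `|l z| <= `|l w| + `|l (z - w)|.
  by rewrite -[in leLHS](subrK w z) addrC linearD ler_normD.
have wz : `|w| <= `|z| + `|z - w|.
  by have := ler_normB z (z - w); rewrite subKr.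
apply: le_trans lw _.
have h1 : `|l w| <= k * `|z| + k * `|z - w|.
  by apply: le_trans (lk _ Sw) _; rewrite -mulrDr ler_wpM2l.
have h2 : `|l (z - w)| <= `|m| * `|z - w|.
  have := lm (z - w); have [->|nz] := eqVneq `|z - w| 0; first by rewrite !mulr0.
  move=> le1; apply: (le_trans le1); apply: ler_wpM2r => //.
  have : 0 <= m * `|z - w| by apply: le_trans le1.
  by rewrite pmulr_lge0 ?lt0r ?nz //= => m0; rewrite ger0_norm.
apply: le_trans (lerD h1 h2) _.
rewrite -addrA lerD2l -mulrDl; apply: ltW; apply: le_lt_trans zw.
by rewrite mulrC ler_wpM2l // lerDl.
Qed.

Section MinTensorProduct.
Context {C : numClosedFieldType} {A B T : cstarAlgType C} {t : A -> B -> T}.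
Hypothesis tP : min_tensor_product t.

Lemma tens_dense : linearly_dense [set t a b | a in [set: A] & b in [set: B]].
Proof. by case: tP. Qed.

(** Lets one leg of a tensor product stand for the other in what follows. *)
Lemma tens_flip : min_tensor_product (fun b a => t a b).
Proof.
have [td [H [K [L [h [pi [rho [sigma [rpi rrho hT rsigma st]]]]]]]]] := tP.
split.
  congr (linearly_dense _): td; apply/seteqP; split=> z.
    by move=> [a _ [b _ <-]]; exists b => //; exists a.
  by move=> [b _ [a _ <-]]; exists a => //; exists b.
exists K, H, L, (fun y x => h x y), rho, pi, sigma; split=> //.
exact: hilbert_tensor_flip.
Qed.

(** Elements of [T] act as bounded operators, so their action on simple tensors
    determines them. *)
Local Lemma sigma_ext (H K L : hilbertType C) (h : H -> K -> L)
    (sigma : T -> L -> L) (X Y : T) :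
  hilbert_tensor h -> concrete_rep sigma ->
  (forall x y, sigma X (h x y) = sigma Y (h x y)) -> X = Y.
Proof.
move=> [_ _ hd] rs XY; apply: (concrete_rep_inj rs) => z.
have [[_ sl] _ _ _] := rs.
apply: (linearly_dense_eq hd (sl X) _ (sl Y)); try exact: concrete_rep_continuous.
by move=> _ [x _ [y _ <-]].
Qed.

Lemma tens_bilinear : bilinear_map t.
Proof.
have [td [H [K [L [h [pi [rho [sigma [rpi rrho hT rsigma st]]]]]]]]] := tP.
have [[pl _] _ _ _] := rpi; have [[rl _] _ _ _] := rrho.
have [[sl _] _ _ _] := rsigma; have [[hl hr] _ _] := hT.
split=> [b c a a' | a c b b']; apply: (sigma_ext hT rsigma) => x y.
  rewrite (sl _ c _ _) !st (pl _ c _ _).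
  exact: hl.
rewrite (sl _ c _ _) !st (rl _ c _ _).
exact: hr.
Qed.

Lemma tensM a b a' b' : t a b * t a' b' = t (a * a') (b * b').
Proof.
have [td [H [K [L [h [pi [rho [sigma [rpi rrho hT rsigma st]]]]]]]]] := tP.
apply: (sigma_ext hT rsigma) => x y.
have [_ pM _ _] := rpi; have [_ rM _ _] := rrho; have [_ sM _ _] := rsigma.
by rewrite sM !st pM rM.
Qed.

Lemma tens_star a b : star (t a b) = t (star a) (star b).
Proof.
have [td [H [K [L [h [pi [rho [sigma [rpi rrho hT rsigma st]]]]]]]]] := tP.
apply: (sigma_ext hT rsigma) => x y.
have [_ _ pS _] := rpi; have [_ _ rS _] := rrho; have [_ _ sS _] := rsigma.
have [_ hdot hd] := hT; have dL := dot_inner_product L.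
apply/eqP; rewrite -subr_eq0; apply/eqP; apply: (orth_dense0 hd).
move=> _ [x' _ [y' _ <-]].
by rewrite -scaleN1r (ipDl dL) (ipZl dL) sS !st !hdot pS rS mulN1r subrr.
Qed.

Lemma tens_slide a b : t a b = t a 1 * t 1 b.
Proof. by rewrite tensM mulr1 mul1r. Qed.

Lemma tens_comm a b : t a 1 * t 1 b = t 1 b * t a 1.
Proof. by rewrite !tensM !mulr1 !mul1r. Qed.

(** On a sum of simple tensors, [t 1 b] acts as the operator [rho b] on the
    second legs of the image under [t 1 1]; the factor [`|t 1 1|] is there
    because [pi 1] and [rho 1] are only known to be projections. *)
Local Lemma norm_tens1 b : `|t 1 b| <= `|t 1 1| * `|b|.
Proof.
have [td [H [K [L [h [pi [rho [sigma [rpi rrho hT rsigma st]]]]]]]]] := tP.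
have [_ _ _ sn] := rsigma; have [[_ sl] _ _ _] := rsigma.
have [_ up] := sn (t 1 b); apply: up => //.
have [_ _ hd] := hT.
have [sb _] := sn (t 1 b).
apply: (dense_norm_bound (sl _) sb hd); first by rewrite mulr_ge0.
move=> z [n [c [s [hs ->]]]].
have [i|xy sxy] := @boolp.choice _ _ (fun i p => s i = h p.1 p.2).
  by have [x _ [y _ <-]] := hs i; exists (x, y).
have [[_ rl] rM _ rn] := rrho; have [[hl _] _ _] := hT.
have hZ a x y : a *: h x y = h (a *: x) y.
  by have [l pl] := linear_pack (hl y); rewrite -[RHS]/(h^~ y _) pl linearZ -pl.
have sE b' : sigma (t 1 b') (\sum_i c i *: s i) =
    \sum_i h (c i *: pi 1 (xy i).1) (rho b' (rho 1 (xy i).2)).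
  have [l pl] := linear_pack (sl (t 1 b')).
  rewrite pl linear_sum; apply: eq_bigr => i _.
  by rewrite linearZ -pl sxy st /= hZ -rM mulr1.
rewrite sE.
have [rb _] := rn b.
apply: le_trans (hilbert_tensor_op_bound hT _ _ (rl b) (normr_ge0 b) rb) _.
have -> : \sum_i h (c i *: pi 1 (xy i).1) (rho 1 (xy i).2) =
   sigma (t 1 1) (\sum_i c i *: s i).
  by rewrite sE; apply: eq_bigr => i _; rewrite -rM mulr1.
rewrite -mulrA [X in _ <= X]mulrCA.
rewrite ler_wpM2l //.
by have [] := sn (t 1 1).
Qed.

Lemma tensr_continuous a : continuous (t a).
Proof.
have [_ tr] := tens_bilinear.
apply: (@linear_norm_continuous _ _ _ _ (`|t a 1| * `|t 1 1|)) => // b.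
rewrite tens_slide; apply: le_trans (cstar_normM _ _) _.
by rewrite -mulrA ler_wpM2l // norm_tens1.
Qed.

(** The vector functionals [b |-> dot (rho b y) y'] separate the points of [B];
    slicing the relation by one of them leaves a linear relation between the
    [f i]. *)
Lemma tens_free n (f : 'I_n -> A) (x : 'I_n -> B) :
  (forall c : 'I_n -> C, \sum_i c i *: f i = 0 -> forall i, c i = 0) ->
  \sum_i t (f i) (x i) = 0 -> forall i, x i = 0.
Proof.
have [td [H [K [L [h [pi [rho [sigma [rpi rrho hT rsigma st]]]]]]]]] := tP.
move=> free sum0 i.
have [[sl _] _ _ _] := rsigma; have [[pl _] _ _ _] := rpi; have [[rl _] _ _ _] := rrho.
have dL := dot_inner_product L; have dH := dot_inner_product H.
apply: (concrete_rep_inj rrho) => y.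
have -> : rho 0 y = 0.
  by have [l lE] := linear_pack (rl y); rewrite -[rho 0 y]/(rho^~ y 0) lE linear0.
(* this choice turns the vanishing of one scalar into [rho (x i) y = 0] *)
pose y' := rho (x i) y.
suff : dot (rho (x i) y) y' = 0.
  by rewrite dot_norm => /eqP; rewrite expf_eq0 normr_eq0 => /eqP.
apply: (free (fun k => dot (rho (x k) y) y')).
apply: (concrete_rep_inj rpi) => u.
have [l lE] := linear_pack (pl u).
rewrite -[pi (\sum_k _) u]/(pi^~ u _) -[pi 0 u]/(pi^~ u 0) lE linear0.
pose v := \sum_k dot (rho (x k) y) y' *: f k.
suff : dot (l v) (l v) = 0.
  by rewrite dot_norm => /eqP; rewrite expf_eq0 normr_eq0 => /eqP.
set u' := (X in dot _ X).
have sumE : sigma (\sum_k t (f k) (x k)) (h u y) = \sum_k h (l (f k)) (rho (x k) y).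
  have [m mE] := linear_pack (sl (h u y)).
  rewrite -[LHS]/(sigma^~ (h u y) _) mE linear_sum; apply: eq_bigr => k _.
  by rewrite -mE st -lE.
have := congr1 (fun z => dot z (h u' y')) sumE; rewrite /= sum0.
have -> : sigma 0 (h u y) = 0.
  have [m mE] := linear_pack (sl (h u y)).
  by rewrite -[LHS]/(sigma^~ (h u y) 0) mE linear0.
rewrite (ip0l dL) (ip_suml dL).
have [_ hdot _] := hT.
move=> sum1; rewrite /v linear_sum (ip_suml dH) [RHS]sum1; apply: eq_bigr => k _.
by rewrite linearZ (ipZl dH) hdot mulrC.
Qed.

End MinTensorProduct.

(** * A criterion for cancellation *)

(** The adjoint is an isometric antilinear bijection. *)
Lemma linearly_dense_star (C : numClosedFieldType) (A : cstarAlgType C) (S : set A) :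
  linearly_dense S -> linearly_dense [set star x | x in S].
Proof.
move=> dS; apply/linearly_denseP => x; rewrite -[x]starK.
set E := cspan _; have [E0 ED Ecl] : closed_subspace E by exact: cspan_closed_subspace.
suff : forall y, [set y | E (star y)] y by apply.
apply: (linearly_dense_ind dS).
  split=> /=; first by rewrite star0.
    by move=> c y z Ey Ez; rewrite starD starZ; exact: ED.
  exact: (closed_preimage star_continuous).
by move=> y Sy /=; apply: cspan_incl; exists y.
Qed.

(** [E], the closed span, is stable under left multiplication by [t a 1] and
    right multiplication by [Delta b].  If [t 1 c] lies in [E], then so does
    [t 1 c * (t a 1 * Delta b) = t a 1 * t 1 c * Delta b]: this makes
    [c |-> t 1 c \in E] stable under products.  Stability under adjoints has to
    be imposed, whence the two conditions on the generators. *)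
Lemma cancellation_criterion (C : numClosedFieldType) (B T : cstarAlgType C)
    (t : B -> B -> T) (Delta : B -> T) (G : set B) :
  min_tensor_product t -> star_morphism Delta -> generates_cstar G ->
  (forall g, G g ->
     cspan [set t a 1 * Delta b | a in [set: B] & b in [set: B]] (t 1 g) /\
     cspan [set t a 1 * Delta b | a in [set: B] & b in [set: B]]
       (t 1 (star g))) ->
  linearly_dense [set t a 1 * Delta b | a in [set: B] & b in [set: B]].
Proof.
set S := [set _ | _ in _ & _ in _] => tP [_ DM D1 _] genG GS.
have cE := cspan_closed_subspace S; set E := cspan S in cE GS.
have [E0 ED Ecl] := cE.
have tlin := tens_bilinear tP.
have lE a x : E x -> E (t a 1 * x).
  apply: (cspan_min (closed_subspace_preimage (mull_linear (t a 1))
    (@mull_continuous _ _ _) cE)).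
  move=> _ [a' _ [b _ <-]]; rewrite /preimage /= mulrA (tensM tP) mulr1.
  by apply: cspan_incl; exists (a * a') => //; exists b.
have rE b x : E x -> E (x * Delta b).
  apply: (cspan_min (closed_subspace_preimage (mulr_linear (Delta b))
    (@mulr_continuous _ _ _) cE)).
  move=> _ [a' _ [b' _ <-]]; rewrite /preimage /= -mulrA -DM.
  by apply: cspan_incl; exists a' => //; exists (b' * b).
have mE c x : E (t 1 c) -> E x -> E (t 1 c * x).
  move=> Ec.
  apply: (cspan_min (closed_subspace_preimage (mull_linear (t 1 c))
    (@mull_continuous _ _ _) cE)).
  move=> _ [a _ [b _ <-]]; rewrite /preimage /= mulrA -(tens_comm tP) -mulrA.
  by apply: lE; exact: rE.
have cpre := closed_subspace_preimage (tlin.2 1) (tensr_continuous tP (a := 1)) cE.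
have full : [set c | E (t 1 c) /\ E (t 1 (star c))] = setT.
  apply: genG; last exact: GS.
  have [p0 pD pcl] := cpre.
  split.
  - by split; [exact: p0 | rewrite star0; exact: p0].
  - move=> c x y [Ex Ex'] [Ey Ey']; split; first exact: pD.
    by rewrite starD starZ; exact: pD.
  - move=> x y [Ex Ex'] [Ey Ey']; split.
      by rewrite -[1]mulr1 -(tensM tP); exact: mE.
    by rewrite starMr -[1]mulr1 -(tensM tP); exact: mE.
  - by move=> x [Ex Ex']; split; rewrite ?starK.
  - apply: closedI; first exact: pcl.
    exact: (closed_preimage star_continuous pcl).
apply/linearly_denseP; apply: (linearly_dense_ind (tens_dense tP) cE).
move=> _ [a _ [b _ <-]]; rewrite (tens_slide tP); apply: lE.
have [Eb _] : [set c | E (t 1 c) /\ E (t 1 (star c))] b by rewrite full.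
exact: Eb.
Qed.

(** * Orthonormal bases for a faithful tracial state *)

Section StateBasis.
Context {C : numClosedFieldType} {M : cstarAlgType C} (omega : M -> C^o).
Hypotheses (omega_state : state omega) (omega_faithful : faithful omega).

(** The inner product of the GNS construction. *)
Definition state_dot (x y : M) : C := omega (star y * x).

Definition onb (n : nat) (f : 'I_n -> M) : Prop :=
  orthonormal state_dot f /\ forall x, expands state_dot f x.

(** Positivity of [omega] at [y + 1] makes [omega y + omega (star y)] real; the
    cases [y = x] and [y = 'i *: x] together give the claim. *)
Lemma state_star x : omega (star x) = (omega x)^*.
Proof.
have [/linear_pack[l lE] opos o1] := omega_state.
have real_sum y : (omega y + omega (star y) : C) \is Num.real.
  have r1 : (omega (star (y + 1) * (y + 1)) : C) \is Num.real by rewrite ger0_real.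
  have r0 : (omega (star y * y) : C) \is Num.real by rewrite ger0_real.
  have e : omega (star (y + 1) * (y + 1)) =
      omega (star y * y) + omega y + (omega (star y) + 1).
    by rewrite starD star1 mulrDr mulr1 mulrDl mul1r -o1 lE !linearD.
  have -> : (omega y + omega (star y) : C) =
      (omega (star (y + 1) * (y + 1)) : C) - omega (star y * y) - 1.
    by rewrite e; ring.
  by rewrite !rpredB ?rpred1.
have /CrealP rx := real_sum x; have /CrealP := real_sum ('i *: x).
rewrite starZ conjCi lE !linearZ -lE /GRing.scale /= rmorphD !rmorphM rmorphN /= conjCi.
move: rx; rewrite rmorphD /=.
move: (omega x : C) (omega (star x) : C) => a b rx ry.
have {}ry : a^* - b^* = b - a.
  apply: (mulfI (neq0Ci C)).
  have -> : 'i * (a^* - b^*) = - (- 'i * a^* + - - 'i * b^*) by ring.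
  by rewrite ry -[RHS]opprK; congr (- _); rewrite /GRing.scale /=; ring.
have two : (2 : C) != 0 by rewrite pnatr_eq0.
apply: (mulfI two).
have -> : 2 * b = (a + b) + (b - a) by ring.
by rewrite -rx -ry; ring.
Qed.

Hypothesis omega_tracial : tracial omega.

Lemma state_inner_product : inner_product state_dot.
Proof.
have [ol opos _] := omega_state; split.
- by move=> c x y z; rewrite /state_dot mulrDr -scale_mulr; exact: ol.
- by move=> x y; rewrite /state_dot -state_star starMr starK.
- by move=> x; exact: opos.
- by move=> x; exact: omega_faithful.
Qed.

Lemma onb_exists : finite_dimensional M -> exists n (f : 'I_n -> M), onb f.
Proof.
move=> [n [e spane]]; have dP := state_inner_product.
have [m [f [fo fe]]] := gram_schmidt dP e.
exists m, f; split=> // x.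
have : lspan (range e) x by rewrite spane.
move=> [k [c [s [se ->]]]].
rewrite /expands; under [RHS]eq_bigr => j _ do rewrite (ip_suml dP) scaler_suml.
rewrite exchange_big /=; apply: eq_bigr => i _.
have {1}-> : s i = \sum_j state_dot (s i) (f j) *: f j.
  by have [i' _ <-] := se i; exact: fe.
rewrite scaler_sumr; apply: eq_bigr => j _.
by rewrite (ipZl dP) scalerA.
Qed.

(** For a trace, [omega (star x * y)] and [omega (y * star x)] agree, so the
    adjoint is antiunitary for the inner product of the state. *)
Lemma onb_star n (f : 'I_n -> M) : onb f -> onb (fun i => star (f i)).
Proof.
move=> [fo fe]; split=> [i j | x].
  by rewrite /state_dot starK omega_tracial [LHS]fo eq_sym.
rewrite /expands -[LHS]starK {1}(fe (star x)) star_sum; apply: eq_bigr => i _.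
by rewrite starZ /state_dot starK -state_star starMr !starK omega_tracial.
Qed.

Lemma onb_free n (f : 'I_n -> M) (c : 'I_n -> C) :
  onb f -> \sum_i c i *: f i = 0 -> forall i, c i = 0.
Proof.
have dP := state_inner_product.
move=> [fo _] sum0 i; have := congr1 (state_dot^~ (f i)) sum0.
rewrite /= (ip_suml dP) (ip0l dP) (bigD1 i) //= (ipZl dP) fo eqxx mulr1.
rewrite big1 ?addr0 // => j ji.
by rewrite (ipZl dP) fo (negbTE ji) mulr0.
Qed.

End StateBasis.

(** * The matrix of coefficients of an action preserving a trace *)

Lemma sum_linear (C : numClosedFieldType) (V W : lmodType C) (n : nat)
    (f : 'I_n -> V -> W) :
  (forall i, linear (f i)) -> linear (fun x => \sum_i f i x).
Proof.
move=> fl c x y; rewrite scaler_sumr -big_split; apply: eq_bigr => i _.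
exact: fl.
Qed.

Lemma sum_continuous (C : numClosedFieldType) (V W : normedModType C) (n : nat)
    (f : 'I_n -> V -> W) :
  (forall i, continuous (f i)) -> continuous (fun x => \sum_i f i x).
Proof.
move=> fc x; apply: cvg_big => [|i _]; [exact: add_continuous | exact: fc].
Qed.

Lemma linear_comp (C : numClosedFieldType) (U V W : lmodType C)
    (g : V -> W) (f : U -> V) : linear g -> linear f -> linear (fun x => g (f x)).
Proof. by move=> gl fl c x y; rewrite fl gl. Qed.

Section Coefficients.
Context {C : numClosedFieldType} {M B : cstarAlgType C} {MB : minTensor M B}.
Variables (omega : M -> C^o) (Phi : M -> MB) (S : MB -> B).
Hypotheses (Phi_morph : star_morphism Phi) (S_slice : is_slice omega S).

Definition coefficients (n : nat) (f : 'I_n -> M) (u : 'I_n -> 'I_n -> B) : Prop :=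
  forall j, Phi (f j) = \sum_i tens (f i) (u i j).

(** The slice map of the functional [omega (star m * _)], obtained from that of
    [omega] alone. *)
Definition coordinate (m : M) (X : MB) : B := S (tens (star m) 1 * X).

Lemma coordinate_linear m : linear (coordinate m).
Proof.
by have [Sl _ _] := S_slice; apply: linear_comp Sl _; exact: mull_linear.
Qed.

Lemma coordinate_continuous m : continuous (coordinate m).
Proof.
have [_ Sc _] := S_slice => X.
by apply: continuous_comp; [exact: mull_continuous | exact: Sc].
Qed.

Lemma coordinate_tens m m' b :
  coordinate m (tens m' b) = state_dot omega m' m *: b.
Proof.
by have [_ _ St] := S_slice; rewrite /coordinate (tensM (@tensP _ _ _ _)) mul1r St.
Qed.

Lemma coordinate_sum n (f : 'I_n -> M) (x : 'I_n -> B) i :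
  orthonormal (state_dot omega) f ->
  coordinate (f i) (\sum_k tens (f k) (x k)) = x i.
Proof.
move=> fo; have [l lE] := linear_pack (coordinate_linear (f i)).
rewrite lE linear_sum -lE (bigD1 i) //= coordinate_tens fo eqxx scale1r.
rewrite big1 ?addr0 // => k ki.
by rewrite coordinate_tens fo (negbTE ki) scale0r.
Qed.

(** Both sides are continuous in [X] and agree on simple tensors.  This is where
    finite dimension of [M] gives an algebraic description of [M (x) B]. *)
Lemma coordinate_expansion n (f : 'I_n -> M) (X : MB) :
  onb omega f -> X = \sum_i tens (f i) (coordinate (f i) X).
Proof.
move=> [_ fe]; have tP := @tensP _ _ _ MB; have [tl tr] := tens_bilinear tP.
apply: (linearly_dense_eq (f := id)
  (g := fun X => \sum_i tens (f i) (coordinate (f i) X)) (tens_dense tP)) => //.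
- by move=> Y; exact: cvg_id.
- by apply: sum_linear => i; apply: linear_comp (tr _) _; exact: coordinate_linear.
- apply: sum_continuous => i Y.
  by apply: continuous_comp; [exact: coordinate_continuous | exact: tensr_continuous].
move=> _ [m _ [b _ <-]].
have [l lE] := linear_pack (tl b).
rewrite {1}(fe m) -[LHS]/((fun m => tens m b) _) lE linear_sum.
apply: eq_bigr => i _; rewrite linearZ -lE coordinate_tens.
have [r rE] := linear_pack (tr (f i)).
by rewrite rE linearZ.
Qed.

Lemma coefficients_exist n (f : 'I_n -> M) :
  onb omega f -> coefficients f (fun i j => coordinate (f i) (Phi (f j))).
Proof. by move=> fb j; exact: coordinate_expansion. Qed.

Lemma coefficients_star n (f : 'I_n -> M) u :
  coefficients f u ->
  coefficients (fun i => star (f i)) (fun i j => star (u i j)).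
Proof.
have [_ _ _ PS] := Phi_morph.
move=> fu j; rewrite PS fu star_sum; apply: eq_bigr => i _.
exact/tens_star/tensP.
Qed.

(** Slice [Phi (star (f i) * f j) = star (Phi (f i)) * Phi (f j)] by [omega]:
    invariance evaluates one side, orthonormality the other. *)
Lemma coefficients_isometry n (f : 'I_n -> M) u :
  onb omega f -> coefficients f u ->
  (forall m, S (Phi m) = omega m *: (1 : B)) ->
  forall i j, \sum_k star (u k i) * u k j = (i == j)%:R.
Proof.
move=> [fo _] fu inv i j; have [_ PM _ PS] := Phi_morph.
have tP := @tensP _ _ _ MB.
have [Sl _ St] := S_slice; have [l lE] := linear_pack Sl.
have := inv (star (f i) * f j).
have -> : omega (star (f i) * f j) = (i == j)%:R by rewrite eq_sym; exact: fo.
rewrite PM PS !fu star_sum mulr_suml lE linear_sum.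
have -> : ((i == j)%:R : C) *: (1 : B) = (i == j)%:R.
  by case: eqP; rewrite ?scale1r ?scale0r.
move=> <-; apply: eq_bigr => k _.
rewrite mulr_sumr linear_sum (bigD1 k) //= tens_star // tensM // -lE St.
have -> : omega (star (f k) * f k) = 1 by have := fo k k; rewrite eqxx.
rewrite scale1r big1 ?addr0 // => q qk.
rewrite tensM // St.
have -> : omega (star (f k) * f q) = 0 by have := fo q k; rewrite (negbTE qk).
by rewrite scale0r.
Qed.

(** The projection [u u^*] fixes the coordinate columns of the elements
    [Phi m * tens 1 a], since these lie in the range of the isometry [u]; by
    density it fixes those of every element of [M (x) B], and [tens (f k) 1] has
    the [k]-th unit vector as coordinate column. *)
Lemma coefficients_coisometry n (f : 'I_n -> M) u :
  onb omega f -> coefficients f u ->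
  (forall m, S (Phi m) = omega m *: (1 : B)) ->
  linearly_dense [set Phi m * tens 1 a | m in [set: M] & a in [set: B]] ->
  forall i k, \sum_j u i j * star (u k j) = (i == k)%:R.
Proof.
move=> fb fu inv dPhi i k; have [fo fe] := fb.
have tP := @tensP _ _ _ MB; have [_ tr] := tens_bilinear tP.
have iso := coefficients_isometry fb fu inv.
pose p l := \sum_j u i j * star (u l j).
have fixp X : \sum_l p l * coordinate (f l) X = coordinate (f i) X.
  have Ll : linear (fun X => \sum_l p l * coordinate (f l) X).
    apply: sum_linear => l; apply: linear_comp (mull_linear _) _.
    exact: coordinate_linear.
  have Lc : continuous (fun X => \sum_l p l * coordinate (f l) X).
    apply: sum_continuous => l Y.
    by apply: continuous_comp; [exact: coordinate_continuous | exact: mull_continuous].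
  have cD := closed_subspace_eq Ll Lc (coordinate_linear (f i))
    (@coordinate_continuous (f i)).
  apply: (linearly_dense_ind dPhi cD) => _ [m _ [a _ <-]].
  have [/linear_pack[P PE] _ _ _] := Phi_morph.
  rewrite (fe m) PE linear_sum mulr_suml.
  apply: (closed_subspace_sum cD) => j.
  rewrite linearZ -PE -scale_mull; apply: (closed_subspaceZ _ cD) => /=.
  have co q : coordinate (f q) (Phi (f j) * tens 1 a) = u q j * a.
    rewrite fu mulr_suml; under eq_bigr => r _ do rewrite tensM // mulr1.
    exact: coordinate_sum.
  rewrite co; under eq_bigr => l _ do rewrite co.
  rewrite /p; under eq_bigr => l _ do rewrite mulr_suml.
  rewrite exchange_big /=.
  transitivity (\sum_q u i q * ((q == j)%:R * a)).
    apply: eq_bigr => q _; rewrite -iso mulr_suml mulr_sumr.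
    by apply: eq_bigr => l _; rewrite !mulrA.
  rewrite (bigD1 j) //= eqxx mul1r big1 ?addr0 // => q qj.
  by rewrite (negbTE qj) mul0r mulr0.
have co q : coordinate (f q) (tens (f k) 1) = (q == k)%:R.
  rewrite coordinate_tens fo eq_sym.
  by case: eqP; rewrite ?scale1r ?scale0r.
have := fixp (tens (f k) 1); rewrite co => <-.
under [RHS]eq_bigr => l _ do rewrite co.
rewrite [RHS](bigD1 k) //= eqxx mulr1 [X in _ + X]big1 ?addr0 // => l lk.
by rewrite (negbTE lk) mulr0.
Qed.

End Coefficients.

(** Both sides of the action equation at [f j] are expanded along [f k] in the
    first leg; coefficients of such expansions are unique by [tens_free]. *)
Lemma coefficients_corepresentation (C : numClosedFieldType)
    (M B : cstarAlgType C) (MB : minTensor M B) (BB : minTensor B B)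
    (MBB : minTensor3 MB BB) (omega : M -> C^o) (Delta : B -> BB)
    (Phi : M -> MB) (n : nat) (f : 'I_n -> M) (u : 'I_n -> 'I_n -> B) :
  state omega -> faithful omega -> quantum_action MBB Delta Phi ->
  onb omega f -> coefficients Phi f u ->
  forall k j, Delta (u k j) = \sum_i tens (u k i) (u i j).
Proof.
move=> os of_ [_ [PI [ID [[PIl _ PIt] [IDl _ IDt] act]]]] fb fu k j.
have [tll tlr] := tens_bilinear (@tenslP _ _ _ _ _ _ MBB).
have [trl trr] := tens_bilinear (@tensrP _ _ _ _ _ _ MBB).
have free c := onb_free os of_ (c := c) fb.
apply/eqP; rewrite -subr_eq0; apply/eqP.
apply: (tens_free (x := fun k => Delta (u k j) - \sum_i tens (u k i) (u i j))
  (@tensrP _ _ _ _ _ _ MBB) free _ k) => {k}.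
have := act (f j); rewrite fu.
have [P PE] := linear_pack PIl; have [I IE] := linear_pack IDl.
have -> : PI (\sum_i tens (f i) (u i j)) =
    \sum_i \sum_k tensr (f k) (tens (u k i) (u i j)).
  rewrite PE linear_sum; apply: eq_bigr => i _; rewrite -PE PIt fu.
  have [l lE] := linear_pack (tll (u i j)).
  rewrite -[LHS]/(tensl^~ (u i j) _) lE linear_sum; apply: eq_bigr => k _.
  by rewrite -lE tens3A.
rewrite IE linear_sum -IE exchange_big /= => E.
transitivity (\sum_k (tensr (f k) (Delta (u k j)) : MBB) -
    \sum_k \sum_i tensr (f k) (tens (u k i) (u i j))).
  rewrite -sumrB; apply: eq_bigr => k _.
  have [r rE] := linear_pack (trr (f k)).
  by rewrite rE linearB linear_sum.
rewrite E; apply/eqP; rewrite subr_eq0; apply/eqP.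
by apply: eq_bigr => k _; rewrite IDt.
Qed.

Lemma slice_coefficients_comb (C : numClosedFieldType) (M B : cstarAlgType C)
    (MB : minTensor M B) (omega : M -> C^o) (Phi : M -> MB)
    (n : nat) (f : 'I_n -> M) (u : 'I_n -> 'I_n -> B) (b : B) :
  star_morphism Phi -> onb omega f -> coefficients Phi f u ->
  slice_coefficients Phi b ->
  exists c : 'I_n -> 'I_n -> C, b = \sum_j \sum_i c i j *: u i j.
Proof.
move=> [Phil _ _ _] [_ fe] fu [eta [S [m [_ _ [Sl _ St] ->]]]].
exists (fun i j => state_dot omega m (f j) * eta (f i)).
have [P PE] := linear_pack Phil; have [l lE] := linear_pack Sl.
rewrite {1}(fe m) PE linear_sum lE linear_sum; apply: eq_bigr => j _.
rewrite !linearZ /= -PE fu linear_sum scaler_sumr; apply: eq_bigr => i _.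
by rewrite -lE St scalerA.
Qed.

Lemma cspan_comb (C : numClosedFieldType) (A T : cstarAlgType C) (E : set T)
    (f : A -> T) (n : nat) (c : 'I_n -> 'I_n -> C) (u : 'I_n -> 'I_n -> A) :
  closed_subspace E -> linear f -> (forall i j, E (f (u i j))) ->
  E (f (\sum_j \sum_i c i j *: u i j)).
Proof.
move=> cE /linear_pack[l ->] Eu; rewrite linear_sum.
apply: (closed_subspace_sum cE) => j; rewrite linear_sum.
apply: (closed_subspace_sum cE) => i; rewrite linearZ.
exact: closed_subspaceZ.
Qed.

Lemma cancellation_coefficients (C : numClosedFieldType)
    (M B : cstarAlgType C) (MB : minTensor M B) (omega : M -> C^o)
    (Phi : M -> MB) (T : cstarAlgType C) (t : B -> B -> T) (Delta : B -> T)
    (n : nat) (f : 'I_n -> M) (u : 'I_n -> 'I_n -> B) :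
  min_tensor_product t -> star_morphism Delta -> star_morphism Phi ->
  generates_cstar (slice_coefficients Phi) ->
  onb omega f -> coefficients Phi f u ->
  (forall i j,
     lspan [set t a 1 * Delta b | a in [set: B] & b in [set: B]] (t 1 (u i j))) ->
  (forall i j,
     lspan [set t a 1 * Delta b | a in [set: B] & b in [set: B]]
       (t 1 (star (u i j)))) ->
  linearly_dense [set t a 1 * Delta b | a in [set: B] & b in [set: B]].
Proof.
move=> tP Dm Pm gen fb fu Eu Eus; apply: (cancellation_criterion tP Dm gen) => b.
move=> /(slice_coefficients_comb Pm fb fu)[c ->].
have cE := cspan_closed_subspace [set t a 1 * Delta b | a in [set: B] & b in [set: B]].
have [_ tr] := tens_bilinear tP.
split; first by apply: (cspan_comb _ cE (tr 1)) => i j; exact: subset_closure.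
have -> : star (\sum_j \sum_i c i j *: u i j) =
    \sum_j \sum_i (c i j)^* *: star (u i j).
  rewrite star_sum; apply: eq_bigr => j _.
  by rewrite star_sum; apply: eq_bigr => i _; rewrite starZ.
by apply: (cspan_comb _ cE (tr 1)) => i j; exact: subset_closure.
Qed.

Lemma lspan_sum (C : numClosedFieldType) (V : normedModType C) (S : set V)
    (n : nat) (x : 'I_n -> V) :
  (forall i, S (x i)) -> lspan S (\sum_i x i).
Proof.
move=> Sx; exists n, (fun _ => 1), x; split=> //.
by apply: eq_bigr => i _; rewrite scale1r.
Qed.

(** Multiplying the left legs of [Delta u] by [u^*] contracts them to the
    identity matrix. *)
Lemma left_leg_elimination (C : numClosedFieldType) (B T : cstarAlgType C)
    (t : B -> B -> T) (Delta : B -> T) (n : nat) (u : 'I_n -> 'I_n -> B) :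
  min_tensor_product t ->
  (forall k j, Delta (u k j) = \sum_i t (u k i) (u i j)) ->
  (forall i j, \sum_k star (u k i) * u k j = (i == j)%:R) ->
  forall i j,
    lspan [set t a 1 * Delta b | a in [set: B] & b in [set: B]] (t 1 (u i j)).
Proof.
move=> tP Du iso i j; have [tl _] := tens_bilinear tP.
have -> : t 1 (u i j) = \sum_k t (star (u k i)) 1 * Delta (u k j).
  under eq_bigr => k _ do rewrite Du mulr_sumr.
  rewrite exchange_big /=.
  transitivity (\sum_l t (i == l)%:R (u l j)).
    rewrite (bigD1 i) //= eqxx big1 ?addr0 // => l li.
    have [m mE] := linear_pack (tl (u l j)).
    by rewrite eq_sym (negbTE li) -[LHS]/(t^~ (u l j) 0) mE linear0.
  apply: eq_bigr => l _; rewrite -iso.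
  have [m mE] := linear_pack (tl (u l j)).
  rewrite -[LHS]/(t^~ (u l j) _) mE linear_sum -mE.
  by apply: eq_bigr => k _; rewrite tensM // mul1r.
by apply: lspan_sum => k; exists (star (u k i)) => //; exists (u k j).
Qed.

(** Exchanging the legs turns the corepresentation equation of [u] into that of
    the transpose of [u]. *)
Lemma right_leg_elimination (C : numClosedFieldType) (B T : cstarAlgType C)
    (t : B -> B -> T) (Delta : B -> T) (n : nat) (u : 'I_n -> 'I_n -> B) :
  min_tensor_product t ->
  (forall k j, Delta (u k j) = \sum_i t (u k i) (u i j)) ->
  (forall i k, \sum_j star (u i j) * u k j = (i == k)%:R) ->
  forall i k,
    lspan [set t 1 b * Delta a | b in [set: B] & a in [set: B]] (t (u i k) 1).
Proof.
move=> tP Du coiso i k.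
apply: (left_leg_elimination (t := fun b a => t a b) (u := fun k i => u i k)
  (tens_flip tP)) => //.
Qed.

Local Open Scope complex_scope.

Theorem theorem7p3 (R : realType) (M B : cstarAlgType R[i])
    (MB : minTensor M B) (BB : minTensor B B)
    (MBB : minTensor3 MB BB) (BBB : minTensor3 BB BB)
    (omega : M -> R[i]^o) (Delta : B -> BB) (Phi : M -> MB)
    (finM : finite_dimensional M)
    (omega_state : state omega)
    (omega_faithful : faithful omega)
    (omega_tracial : tracial omega)
    (Delta_cqs : compact_quantum_semigroup BBB Delta)
    (Phi_action : quantum_action MBB Delta Phi)
    (Phi_gen : generates_cstar (slice_coefficients Phi))
    (omega_inv : invariant_functional omega Phi) :
  linearly_dense [set tens a 1 * Delta b | a in [set: B] & b in [set: B]] /\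
  (linearly_dense [set Phi m * tens 1 a | m in [set: M] & a in [set: B]] ->
   linearly_dense [set Delta a * tens 1 b | a in [set: B] & b in [set: B]]).
Proof.
have [Dm _] := Delta_cqs; have [Pm _] := Phi_action.
have [S [Ss inv]] := omega_inv.
have tP := @tensP _ _ _ BB.
have [n [f fb]] := onb_exists omega_state omega_faithful finM.
pose u i j := coordinate S (f i) (Phi (f j)).
have fu : coefficients Phi f u by exact: (coefficients_exist Phi Ss fb).
have fb' := onb_star omega_state omega_tracial fb.
have fu' := coefficients_star Pm fu.
have Du := coefficients_corepresentation omega_state omega_faithful Phi_action fb fu.
have Du' := coefficients_corepresentation omega_state omega_faithful Phi_action fb' fu'.
split.
  apply: (cancellation_coefficients tP Dm Pm Phi_gen fb fu).
    apply: (left_leg_elimination tP Du).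
    exact: (coefficients_isometry Pm Ss fb fu inv).
  apply: (left_leg_elimination tP Du').
  exact: (coefficients_isometry Pm Ss fb' fu' inv).
move=> dPhi.
(* here [u] and its entrywise adjoint exchange roles: the adjoint's
   [u u^* = 1] is what eliminates the right legs of [Delta u] *)
have co := coefficients_coisometry Pm Ss fb fu inv dPhi.
have co' := coefficients_coisometry Pm Ss fb' fu' inv dPhi.
have dflip : linearly_dense [set tens 1 b * Delta a | b in [set: B] & a in [set: B]].
  apply: (cancellation_coefficients (tens_flip tP) Dm Pm Phi_gen fb fu).
    apply: (right_leg_elimination tP Du) => i k.
    by rewrite -co'; apply: eq_bigr => j _; rewrite starK.
  apply: (right_leg_elimination tP Du') => i k.
  by rewrite -co; apply: eq_bigr => j _; rewrite starK.
have [_ DM _ DS] := Dm.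
congr (linearly_dense _): (linearly_dense_star dflip); apply/seteqP; split=> z.
  move=> [_ [b _ [a _ <-]] <-]; rewrite starMr -DS tens_star // star1.
  by exists (star a) => //; exists (star b).
move=> [a _ [b _ <-]]; exists (tens 1 (star b) * Delta (star a)).
  by exists (star b) => //; exists (star a).
by rewrite starMr DS tens_star // star1 !starK.
Qed.
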